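(* The DCell $D_{k,n}$ is super-$\lambda_2$ whenever either $k\geq3$ and $n\geq2$, or $k=2$ and $n=2$. That is, every minimum $2$-restricted edge-cut $F$ of $D_{k,n}$ is such that $D_{k,n}-F$ has a component consisting of exactly two adjacent vertices.
   Context: DCell $D_{k,n}$ ($n\geq 2$, $k\geq 0$) is defined recursively. $D_{0,n}$ is the complete graph $K_n$ on vertices $0,1,\dots,n-1$. Let $t_{k,n}=|V(D_{k,n})|$. For $k\geq1$, $D_{k,n}$ is built from $t_{k-1,n}+1$ disjoint copies $D^0_{k-1,n},\dots,D^{t_{k-1,n}}_{k-1,n}$ of $D_{k-1,n}$; a vertex of copy $D^i_{k-1,n}$ is labeled $(i,a_{k-1},\dots,a_0)$, where $(a_{k-1},\dots,a_0)$ is its label in $D_{k-1,n}$, and its index within the copy is $uid_{k-1}=a_0+\sum_{l=1}^{k-1}a_l t_{l-1,n}$. For each pair $a<b$ of copy indices, one edge joins the vertex of $D^a_{k-1,n}$ with $uid_{k-1}=b-1$ to the vertex of $D^b_{k-1,n}$ with $uid_{k-1}=a$. An edge set $F$ is an $m$-restricted edge-cut of $G$ if $G-F$ is disconnected and every component has at least $m$ vertices; $G$ is super-$\lambda_m$ if every minimum $m$-restricted edge-cut isolates a connected subgraph on exactly $m$ vertices. *)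

(* Defs.v *)
From mathcomp Require Import all_boot.

Set Implicit Arguments.
Unset Strict Implicit.
Unset Printing Implicit Defensive.

Section RestrictedEdgeCuts.

(* A finite simple graph is given by its adjacency relation [e] on the vertex
   type [V], meant to be symmetric and irreflexive; an edge is the set of its
   two endpoints. *)
Variables (V : finType) (e : rel V).

Definition edge_set : {set {set V}} :=
  [set [set p.1; p.2] | p : V * V & e p.1 p.2].

Definition del_edges (F : {set {set V}}) : rel V :=
  [rel x y | e x y && ([set x; y] \notin F)].

Definition component (x : V) : {set V} := [set y | connect e x y].

Definition components : {set {set V}} := [set component x | x : V].

Definition connected_graph : Prop := forall x y : V, connect e x y.

End RestrictedEdgeCuts.

Section SuperLambda.

Variables (V : finType) (e : rel V) (m : nat).

Definition restricted_edge_cut (F : {set {set V}}) : Prop :=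
  [/\ F \subset edge_set e,
      ~ connected_graph (del_edges e F)
    & forall C, C \in components (del_edges e F) -> m <= #|C|].

Definition min_restricted_edge_cut (F : {set {set V}}) : Prop :=
  restricted_edge_cut F /\
  forall F', restricted_edge_cut F' -> #|F| <= #|F'|.

(* The isolated subgraph is connected because it is a component of G - F. *)
Definition super_lambda : Prop :=
  forall F, min_restricted_edge_cut F ->
  exists2 C, C \in components (del_edges e F) & #|C| = m.

End SuperLambda.

(* The label (a_k, ..., a_0) is the nested pair (a_k, (..., (a_1, a_0))); the
   leading digit a_k ranges over the t_(k-1) + 1 copies, where
   t_(k-1) = #|dcell_vertex n k.-1|. *)
Fixpoint dcell_vertex (n k : nat) : finType :=
  if k is k'.+1 then ('I_(#|dcell_vertex n k'|.+1) * dcell_vertex n k')%type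
  else 'I_n.

(* uid_k = a_0 + \sum_(1 <= l <= k) a_l * t_(l-1), unrolled on the leading
   digit. *)
Fixpoint uid (n k : nat) : dcell_vertex n k -> nat :=
  match k return dcell_vertex n k -> nat with
  | 0 => fun a0 : 'I_n => a0 : nat
  | k'.+1 => fun u => u.1 * #|dcell_vertex n k'| + uid u.2
  end.

(* The edge between copies a < b, oriented from copy a to copy b. *)
Definition dcell_link (n k : nat) (u v : dcell_vertex n k.+1) : bool :=
  [&& u.1 < v.1, uid u.2 == v.1.-1 & uid v.2 == u.1].

Fixpoint dcell_adj (n k : nat) : rel (dcell_vertex n k) :=
  match k return rel (dcell_vertex n k) with
  | 0 => fun x y : 'I_n => x != y
  | k'.+1 => fun u v =>
      [|| (u.1 == v.1) && dcell_adj u.2 v.2, dcell_link u v | dcell_link v u]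
  end.

Lemma dcell_adj_sym n k : symmetric (@dcell_adj n k).
Proof.
elim: k => [|k IHk] x y /=; first by rewrite eq_sym.
by rewrite eq_sym IHk; congr orb; rewrite orbC.
Qed.

Lemma dcell_adj_irr n k : irreflexive (@dcell_adj n k).
Proof.
elim: k => [|k IHk] x /=; first by rewrite eqxx.
by rewrite /dcell_link IHk ltnn /= andbF.
Qed.

(* Main.v *)
(* Write d = n - 1 + k for the degree of D_(k,n). Isolating an edge shows that a
   minimum 2-restricted cut has at most 2d - 2 edges, so it suffices that every S
   with at least three vertices inside and outside has edge boundary at least
   2d - 1. Cut S along the t + 1 copies of D_(k-1,n) and let m of the slices be
   mixed, i.e. neither empty nor full. Each mixed slice has inner boundary at least
   d - 1 = lambda(D_(k-1,n)), so m >= 3 is enough. Otherwise the copies are joined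
   pairwise by single edges, so full and empty slices together give many cross
   edges, and if S meets only two copies, some vertex of S has its cross edge
   leaving S. When S lies in a single copy, its boundary there grows by #|S|, and
   one descends, with the weight of #|S| increasing at each level. *)
Require Import Defs.
From mathcomp Require Import all_boot zify.

Set Implicit Arguments.
Unset Strict Implicit.
Unset Printing Implicit Defensive.

(** * Edge boundaries of vertex sets *)

Section EdgeBoundary.

Variables (V : finType) (e : rel V).

(** Pairs are oriented from inside to outside, so each boundary edge counts once. *)
Definition boundary (S : {set V}) : {set V * V} :=
  [set p | [&& p.1 \in S, p.2 \notin S & e p.1 p.2]].

Lemma card_boundaryC (S : {set V}) :
  symmetric e -> #|boundary (~: S)| = #|boundary S|.
Proof.
move=> e_sym; have swapK : cancel (fun p : V * V => (p.2, p.1)) (fun p => (p.2, p.1)).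
  by case.
rewrite -(card_imset _ (can_inj swapK)); apply: eq_card => -[x y].
apply/imsetP/idP => [[[u v]] | Hxy].
  by rewrite !inE negbK /= => /and3P[Hu Hv Huv] [-> ->]; rewrite Hu Hv e_sym.
exists (y, x) => //; move: Hxy; rewrite !inE negbK /= => /and3P[-> -> Hxy].
by rewrite e_sym.
Qed.

(** An edge leaving [S] determines which endpoint is inside, so forgetting the orientation is
    injective on the boundary. *)
Lemma card_boundary_le_cut (S : {set V}) (F : {set {set V}}) :
  (forall x y, x \in S -> y \notin S -> e x y -> [set x; y] \in F) ->
  #|boundary S| <= #|F|.
Proof.
move=> SF; rewrite -(card_in_imset (f := fun p : V * V => [set p.1; p.2])).
  apply: subset_leq_card; apply/subsetP => q /imsetP[[x y] + ->].
  by rewrite inE /= => /and3P[xS yS xy]; apply: SF.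
move=> [x y] [u v]; rewrite !inE /= => /and3P[xS yS _] /and3P[uS vS _] Exy.
have : x \in [set u; v] by rewrite -Exy set21.
have : y \in [set u; v] by rewrite -Exy set22.
rewrite !inE => /orP[] /eqP Ey; first by rewrite Ey uS in yS.
by case/orP => /eqP Ex; [rewrite Ex Ey | rewrite Ex (negbTE vS) in xS].
Qed.

End EdgeBoundary.

(* The step from [D_(k-1,n)] to [D_(k,n)], for an arbitrary graph [e] on [T]
   whose vertices are numbered by [id]. *)
Section JoinedCopies.

Variables (T : finType) (e : rel T) (id : T -> nat).
Hypothesis id_lt : forall x, id x < #|T|.
Hypothesis id_inj : injective id.

Local Notation V := ('I_#|T|.+1 * T)%type.

Definition link (u v : V) : bool :=
  [&& u.1 < v.1, id u.2 == v.1.-1 & id v.2 == u.1].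

Definition cross (u v : V) : bool := link u v || link v u.

Definition copies_adj (u v : V) : bool :=
  (u.1 == v.1) && e u.2 v.2 || cross u v.

(** The copy reached by the cross edge at [u]: [bump] skips the index of the own copy, which unites
    the cases [b - 1] and [a] of the linking rule. *)
Definition target (u : V) : nat := bump u.1 (id u.2).

Lemma crossE (u v : V) :
  cross u v = (target u == v.1) && (target v == u.1).
Proof.
rewrite /cross /link /target /bump /=.
have := id_lt u.2; have := id_lt v.2; have := ltn_ord u.1; have := ltn_ord v.1.
lia.
Qed.

Lemma target_neq (u : V) : target u != u.1.
Proof. by rewrite eq_sym neq_bump. Qed.

Lemma target_lt (u : V) : target u < #|T|.+1.
Proof. by rewrite /target /bump; have := id_lt u.2; lia. Qed.

Lemma target_inj (u v : V) : u.1 = v.1 -> target u = target v -> u = v.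
Proof.
case: u v => [i x] [j y] /= <-; rewrite /target /= => /(can_inj (bumpK i)).
by move/id_inj => ->.
Qed.

Lemma id_surj h : h < #|T| -> exists x, id x = h.
Proof.
move=> h_lt; pose f x := Ordinal (id_lt x).
have f_inj : injective f by move=> x y [/id_inj].
have [|g _ fK] := inj_card_bij f_inj; first by rewrite card_ord.
by exists (g (Ordinal h_lt)); have := congr1 val (fK (Ordinal h_lt)).
Qed.

Lemma target_surj (i j : 'I_#|T|.+1) :
  i != j -> exists x, target (i, x) = j.
Proof.
move=> ij; have /id_surj[x Ex] : unbump i j < #|T|.
  by rewrite /unbump; move: ij (ltn_ord i) (ltn_ord j); rewrite -val_eqE /=; lia.
by exists x; rewrite /target /= Ex unbumpK // inE eq_sym val_eqE.
Qed.

Lemma cross_exists (i j : 'I_#|T|.+1) :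
  i != j -> exists x y, cross (i, x) (j, y).
Proof.
move=> ij; have [x Ex] := target_surj ij.
have [|y Ey] := @target_surj j i; first by rewrite eq_sym.
by exists x, y; rewrite crossE Ex Ey !eqxx.
Qed.

Lemma cross_total u : exists v, cross u v.
Proof.
have [|y Ey] := @target_surj (Ordinal (target_lt u)) u.1.
  by rewrite -val_eqE target_neq.
by exists (Ordinal (target_lt u), y); rewrite crossE Ey !eqxx.
Qed.

Lemma cross_unique u v w : cross u v -> cross u w -> v = w.
Proof.
rewrite !crossE => /andP[/eqP uv /eqP vu] /andP[/eqP uw /eqP wu].
by apply: target_inj; [apply: val_inj; rewrite /= -uv | rewrite vu].
Qed.

Lemma cross_neq u v : cross u v -> u.1 != v.1.
Proof.
by rewrite crossE => /andP[/eqP uv _]; rewrite -val_eqE /= -uv eq_sym target_neq.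
Qed.

(** Each vertex gains exactly one cross edge. *)
Lemma card_copies_adj u :
  #|[set v | copies_adj u v]| = #|[set y | e u.2 y]|.+1.
Proof.
have [w uw] := cross_total u.
have -> : [set v | copies_adj u v] = w |: [set (u.1, y) | y in [set y | e u.2 y]].
  apply/setP => v; rewrite in_setU1 inE; apply/orP/orP => -[].
  - case: v => j y /= /andP[/eqP <- uy]; right; apply/imsetP.
    by exists y; rewrite ?inE.
  - by move/(cross_unique uw) => <-; left.
  - by move/eqP ->; right.
  by case/imsetP => y; rewrite inE => uy ->; left; rewrite /= eqxx.
rewrite cardsU1 card_imset; last by move=> y z [].
case: imsetP => // -[y _ Ew]; have := cross_neq uw.
by rewrite Ew eqxx.
Qed.

(** * Slices of a vertex set along the copies *)

Section Slices.

Variable S : {set V}.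

Definition slice (i : 'I_#|T|.+1) : {set T} := [set x | (i, x) \in S].

Definition full : {set 'I_#|T|.+1} := [set i | slice i == setT].
Definition void : {set 'I_#|T|.+1} := [set i | slice i == set0].
Definition mixed : {set 'I_#|T|.+1} :=
  [set i | (slice i != setT) && (slice i != set0)].

Definition cross_boundary : {set V * V} :=
  [set p | [&& p.1 \in S, p.2 \notin S & cross p.1 p.2]].

Lemma card_slices : #|S| = \sum_i #|slice i|.
Proof.
rewrite -sum1_card (partition_big fst predT) //=; apply: eq_bigr => i _.
rewrite sum1dep_card -(card_imset (slice i) (f := pair i)); last by move=> x y [].
apply: eq_card => -[j x]; rewrite !inE /=.
apply/andP/imsetP => [[Sx /eqP <-] | [y]]; first by exists x; rewrite ?inE.
by rewrite inE => Sy [-> ->].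
Qed.

Lemma boundary_slices :
  \sum_i #|boundary e (slice i)| + #|cross_boundary| <=
  #|boundary copies_adj S|.
Proof.
rewrite -(cardsID [set p : V * V | p.1.1 == p.2.1] (boundary copies_adj S)).
apply: leq_add; last first.
  apply: subset_leq_card; apply/subsetP => p; rewrite !inE => /and3P[-> -> pc].
  by rewrite (cross_neq pc) /copies_adj pc orbT.
rewrite -[X in _ <= X]sum1_card (partition_big (fun p => p.1.1) predT) //=.
apply: leq_sum => i _; rewrite sum1dep_card.
rewrite -(card_imset _ (f := fun p : T * T => ((i, p.1), (i, p.2)))).
  apply: subset_leq_card; apply/subsetP => q /imsetP[[x y] + ->].
  by rewrite !inE /copies_adj /= => /and3P[-> -> ->]; rewrite !eqxx.
by case=> [x y] [z t] [-> ->].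
Qed.

Lemma leq_card_slices : #|T| * #|full| + #|mixed| <= #|S|.
Proof.
rewrite card_slices mulnC -sum_nat_const -sum1_card big_mkcond.
rewrite [X in _ + X <= _]big_mkcond -big_split /=.
apply: leq_sum => i _; rewrite !inE.
case: eqP => [->|_]; rewrite ?cardsT ?addn0 //=.
by case: eqP => // /eqP; rewrite -cards_eq0 -lt0n.
Qed.

Lemma card_slices_leq : #|S| <= #|T| * (#|full| + #|mixed|).
Proof.
rewrite card_slices mulnC mulnDl -!sum_nat_const [X in _ <= X + _]big_mkcond.
rewrite [X in _ <= _ + X]big_mkcond -big_split /=.
apply: leq_sum => i _; rewrite !inE.
case: eqP => [->|_]; rewrite ?cardsT ?leq_addr //=.
by case: eqP => [->|_]; rewrite ?cards0 ?max_card.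
Qed.

Lemma leq_mixed_sum d :
  (forall A : {set T}, A != set0 -> A != setT -> d <= #|boundary e A|) ->
  d * #|mixed| <= \sum_i #|boundary e (slice i)|.
Proof.
move=> leq_d; rewrite mulnC -sum_nat_const big_mkcond /=.
by apply: leq_sum => i _; rewrite inE; case: ifP => // /andP[? ?]; apply: leq_d.
Qed.

(* A pair of copies carries a single cross edge, so at most [#|A| * (#|A| - 1)]
   vertices of [S] have their cross edge inside [S]. *)
Lemma card_leq_cross (A : {set 'I_#|T|.+1}) :
  (forall i, i \notin A -> slice i = set0) ->
  #|S| + #|A| <= #|cross_boundary| + #|A| * #|A|.
Proof.
move=> SA; have inA u : u \in S -> u.1 \in A.
  case: u => i x; apply: contraLR => /SA /setP/(_ x).
  by rewrite !inE => ->.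
(* Vertices of [S] outside [B] start an edge of the cross boundary; those in [B] are counted by
   ordered pairs of copies. *)
pose B := [set u | [exists v in S, cross u v]].
rewrite -(cardsID B S) [X in X + #|A|]addnC -addnA; apply: leq_add.
  apply: leq_trans (leq_imset_card fst _); apply: subset_leq_card.
  apply/subsetP => u; rewrite !inE => /andP[uB uS].
  have [v uv] := cross_total u; apply/imsetP; exists (u, v) => //.
  rewrite inE /= uS uv andbT; apply: contra uB => vS.
  by apply/existsP; exists v; rewrite vS.
(* [g u] is the ordered pair of distinct copies joined by the cross edge at [u]; on [S :&: B] these
   pairs and the diagonal of [A] fit disjointly into [setX A A]. *)
pose g (u : V) := (u.1, inord (target u) : 'I_#|T|.+1).
rewrite -(card_in_imset (f := g) (D := S :&: B)); last first.
  move=> u v _ _ [uv /(congr1 val)]; rewrite /= !inordK ?target_lt //.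
  exact: target_inj.
rewrite -cardsX -(card_imset A (f := fun i => (i, i))); last by move=> i j [].
set D1 := imset _ _; set D2 := imset _ _.
have D12 : [disjoint D1 & D2].
  apply/pred0P => -[i j] /=; apply/andP => -[/imsetP[u _ [-> ->]] /imsetP[k _]].
  case=> <- /(congr1 val)/eqP; rewrite /= inordK ?target_lt //.
  by rewrite (negbTE (target_neq u)).
rewrite -cardsUI (disjoint_setI0 D12) cards0 addn0.
apply: subset_leq_card; rewrite subUset; apply/andP; split;
  apply/subsetP => p; last first.
  by case/imsetP => i iA ->; rewrite !inE /= iA.
case/imsetP => u; rewrite !inE => /andP[uS /existsP[v /andP[vS uv]]] -> /=.
rewrite inA //=; suff -> : inord (target u) = v.1 by rewrite inA.
apply: val_inj; rewrite /= inordK ?target_lt //.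
by move: uv; rewrite crossE => /andP[/eqP].
Qed.

(** With only one copy involved, every cross edge at [S] leaves [S]. *)
Lemma card_single_slice i :
  (forall j, j != i -> slice j = set0) ->
  #|S| = #|slice i| /\
  #|boundary e (slice i)| + #|S| <= #|boundary copies_adj S|.
Proof.
move=> Si; split.
  rewrite card_slices (bigD1 i) //= big1 ?addn0 // => j /Si ->; exact: cards0.
apply: leq_trans boundary_slices; apply: leq_add.
  by rewrite (bigD1 i) //= leq_addr.
have := @card_leq_cross [set i]; rewrite cards1 muln1 leq_add2r; apply=> j.
by rewrite inE => /Si.
Qed.

Hypothesis T_gt0 : 0 < #|T|.

Lemma set0_neqT : set0 != [set: T].
Proof. by rewrite eq_sym -cards_eq0 cardsT -lt0n. Qed.

(** Positivity of [#|T|] keeps [full] and [void] disjoint. *)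
Lemma card_copies : #|full| + #|void| + #|mixed| = #|T|.+1.
Proof.
rewrite -[RHS]card_ord -(cardsC (full :|: void)) cardsU.
have -> : full :&: void = set0.
  apply/setP => i; rewrite !inE; apply/negbTE/andP => -[/eqP ET /eqP E0].
  by have := set0_neqT; rewrite -ET -E0 eqxx.
rewrite cards0 subn0; congr (_ + _).
by apply: eq_card => i; rewrite !inE negb_or.
Qed.

Lemma card_full_void : #|full| * #|void| <= #|cross_boundary|.
Proof.
rewrite -cardsX.
apply: leq_trans (leq_imset_card (fun p : V * V => (p.1.1, p.2.1)) _).
apply: subset_leq_card; apply/subsetP => -[i j].
rewrite !inE /= => /andP[/eqP Fi /eqP Vj].
have ij : i != j.
  by apply: contra_neq set0_neqT => ij; rewrite -Fi -Vj ij.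
have [x [y xy]] := cross_exists ij.
apply/imsetP; exists ((i, x), (j, y)) => //; rewrite inE /= xy.
have := in_setT x; rewrite -Fi inE => ->.
by have := in_set0 y; rewrite -Vj inE => ->.
Qed.

End Slices.

End JoinedCopies.

(** * Components and restricted edge-cuts *)

Section IsolatedEdges.

Variables (V : finType) (e : rel V).
Hypotheses (e_sym : symmetric e) (e_irr : irreflexive e).

Lemma del_edges_sym (F : {set {set V}}) : symmetric (del_edges e F).
Proof. by move=> x y; rewrite /del_edges /= e_sym setUC. Qed.

(** [S] is one component and its complement contains another, so both inherit the bound [m]. *)
Lemma cut_boundary (F : {set {set V}}) m :
  ~ connected_graph (del_edges e F) ->
  (forall C, C \in components (del_edges e F) -> m <= #|C|) ->
  exists S : {set V}, [/\ m <= #|S|, m <= #|~: S| & #|boundary e S| <= #|F|].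
Proof.
set e' := del_edges e F => not_conn le_m.
have e'_sym : connect_sym e' by apply: sym_connect_sym; apply: del_edges_sym.
have [/forallP conn | ] := boolP [forall x, [forall y, connect e' x y]].
  by case: not_conn => x y; apply: (forallP (conn x)).
rewrite negb_forall => /existsP[x]; rewrite negb_forall => /existsP[y not_xy].
exists (component e' x); split.
- by apply: le_m; apply: imset_f.
- apply: leq_trans (le_m (component e' y) (imset_f _ _)) _ => //.
  apply: subset_leq_card; apply/subsetP => z; rewrite !inE => yz.
  by apply: contra not_xy => xz; apply: connect_trans xz _; rewrite e'_sym.
apply: card_boundary_le_cut => u v; rewrite !inE => xu xv uv.
apply: contraR xv => uvF; apply: connect_trans xu (connect1 _).
by rewrite /e' /del_edges /= uv.
Qed.

(** A path between the two vertices starts with an edge inside [C]; irreflexivity forces this edge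
    to join them. *)
Lemma pair_component_adj (F : {set {set V}}) (C : {set V}) :
  C \in components (del_edges e F) -> #|C| = 2 ->
  exists x y, e x y /\ C = [set x; y].
Proof.
set e' := del_edges e F => /imsetP[z _ EC] /eqP/cards2P[x [y [xy Exy]]].
have e'_sym : connect_sym e' by apply: sym_connect_sym; apply: del_edges_sym.
have inC u : (u \in C) = connect e' z u by rewrite EC inE.
have zx : connect e' z x by rewrite -inC Exy set21.
have: connect e' x y.
  by rewrite e'_sym in zx; apply: connect_trans zx _; rewrite -inC Exy set22.
case/connectP => -[|w p] /= => [_ Eyx|]; first by rewrite Eyx eqxx in xy.
case/andP => xw _ _; exists x, y; split=> //.
have: w \in C by rewrite inC; apply: connect_trans zx (connect1 xw).
case/andP: xw => xw _; rewrite Exy !inE => /orP[]/eqP Ew; last by rewrite -Ew.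
by rewrite Ew e_irr in xw.
Qed.

(** [F] consists of the edges leaving [{x, y}], at most [d - 1] at each end. *)
Lemma edge_isolating_cut d x y :
  2 < d -> (forall z, #|[set w | e z w]| = d) -> e x y ->
  exists2 F, restricted_edge_cut e 2 F & #|F| <= d.-1.*2.
Proof.
move=> d_gt2 deg xy; pose S := [set x; y].
have card_nbh u v : e u v -> #|[set w | e u w] :\ v| = d.-1.
  by move=> uv; rewrite -(deg u) (cardsD1 v [set w | e u w]) inE uv.
pose F := [set [set p.1; p.2] | p in boundary e S].
have outF u v : (u \in S) = (v \in S) -> [set u; v] \notin F.
  move=> uvS; apply/imsetP => -[[a b]]; rewrite inE /= => /and3P[aS bS _] E.
  have: a \in [set u; v] by rewrite E set21.
  have: b \in [set u; v] by rewrite E set22.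
  rewrite !in_set2 => /orP[]/eqP Eb /orP[]/eqP Ea; move: aS bS;
  by rewrite Ea Eb ?uvS => ->.
exists F; last first.
  apply: leq_trans (leq_imset_card _ _) _.
  apply: (@leq_trans #|pair x @: ([set w | e x w] :\ y) :|:
                       pair y @: ([set w | e y w] :\ x)|).
    apply: subset_leq_card; apply/subsetP => -[u v]; rewrite !inE /=.
    case/and3P=> /orP[]/eqP-> /norP[vx vy] uv; apply/orP; [left | right];
    by apply: imset_f; rewrite !inE uv ?vx ?vy.
  have pair_inj u : injective (pair u : V -> V * V) by move=> v w [].
  apply: leq_trans (leq_card_setU _ _) _; rewrite !card_imset //.
  by rewrite (card_nbh x y xy) (card_nbh y x) 1?e_sym // addnn.
split.
- apply/subsetP => q /imsetP[[a b] + ->]; rewrite inE /= => /and3P[_ _ ab].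
  by apply/imsetP; exists (a, b); rewrite ?inE.
- move=> conn; have S_closed : closed (del_edges e F) (mem S).
    move=> u v /andP[uv uvF]; apply/eqP; apply: contraR uvF => uvS.
    have {uvS} : (u \in S) != (v \in S) by [].
    case uS: (u \in S); case vS: (v \in S) => // _; [|rewrite setUC];
      apply/imsetP; [exists (u, v) | exists (v, u)] => //; rewrite inE /= uS vS //.
    by rewrite e_sym.
  (* A neighbour [w] of [x] other than [y] lies outside [S], which no surviving edge leaves. *)
  have /card_gt0P[w] : 0 < #|[set w | e x w] :\ y| by rewrite card_nbh //; lia.
  rewrite !inE => /andP[wy xw]; have := closed_connect S_closed (conn x w).
  rewrite !inE eqxx /= (negbTE wy) orbF => /esym/eqP wx.
  by rewrite wx e_irr in xw.
move=> C /imsetP[z _ ->].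
suff [w zw wzS] : exists2 w, e z w & (z \in S) = (w \in S).
  have {}wzF := outF _ _ wzS.
  apply: (@leq_trans #|[set z; w]|).
    by rewrite cards2; case: eqP zw => // ->; rewrite e_irr.
  apply: subset_leq_card; apply/subsetP => u; rewrite !inE => /orP[]/eqP->.
    exact: connect0.
  by apply: connect1; rewrite /del_edges /= zw.
have [zS | zS] := boolP (z \in S).
  by move: zS; rewrite !inE => /orP[]/eqP->; [exists y | exists x] => //;
     rewrite 1?e_sym // !inE !eqxx ?orbT.
(* At most two neighbours of [z] lie in [S], so [2 < d] leaves one outside. *)
have /card_gt0P[w] : 0 < #|[set w | e z w] :\: S|.
  have := cardsID S [set w | e z w]; rewrite deg.
  have := subset_leq_card (subsetIr [set w | e z w] S).
  have := cards2 x y; rewrite -/S; lia.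
by rewrite !inE => /andP[wS zw]; exists w; rewrite // !inE (negbTE wS).
Qed.

End IsolatedEdges.

(** * Elementary inequalities for the counting *)

Lemma leq_pred_mul_sub s m : 0 < s -> s < m -> m.-1 <= s * (m - s).
Proof. by move=> s_gt0 /subnKC <-; rewrite addSnnS addKn; nia. Qed.

(** [s * (m - s)] is the boundary of an [s]-set in the complete graph on [m] vertices; [c * s] is
    the gain from [c] further levels. *)
Lemma leq_mul_sub_weighted s m c :
  3 <= c -> 3 <= s -> s < m -> 2 * (m + c) <= s * (m - s) + c * s + 3.
Proof. by move=> c_ge3 s_ge3 /subnKC <-; rewrite addSnnS addKn; nia. Qed.

Lemma leq_add_mul1 c m : 0 < c -> 0 < m -> c + m <= c * m + 1.
Proof. by case: c m => [|c] [|m] // _ _; rewrite mulSn mulnS; lia. Qed.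

(** * Size, numbering and degree of DCell *)

Section DCell.

Variable n : nat.
Hypothesis n_ge2 : 2 <= n.

Local Notation t k := #|dcell_vertex n k|.

Lemma card_dcell0 : t 0 = n.
Proof. exact: card_ord. Qed.

Lemma card_dcellS k : t k.+1 = (t k).+1 * t k.
Proof. by rewrite [LHS]card_prod card_ord. Qed.

Lemma card_dcell_ge k : n + k <= t k.
Proof.
elim: k => [|k IHk]; first by rewrite card_dcell0 addn0.
by rewrite card_dcellS; nia.
Qed.

(** From level 1 on the size is quadratic in the previous one. The bound fails at level 0, where
    [t 0 = n]. *)
Lemma card_dcell_ge2 k : 0 < k -> 2 * (n + k) <= (t k).+1.
Proof.
case: k => // k _; have := card_dcell_ge k; rewrite card_dcellS.
move=> le_t; have : 2 * t k <= t k * t k by rewrite leq_mul2r; lia.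
rewrite mulSn; lia.
Qed.

Lemma card_dcell_gt0 k : 0 < t k.
Proof. by have := card_dcell_ge k; lia. Qed.

Lemma uid_lt k (u : dcell_vertex n k) : uid u < t k.
Proof.
elim: k u => [|k IHk] u; first by rewrite card_dcell0 ltn_ord.
rewrite card_dcellS mulSn addnC /= -addnS leq_add //.
by rewrite leq_mul2r -ltnS ltn_ord orbT.
Qed.

Lemma uid_inj k : injective (@uid n k).
Proof.
elim: k => [|k IHk]; first exact: val_inj.
move=> [i x] [j y] /= Euv; have xt := uid_lt x; have yt := uid_lt y.
have Eij : i = j.
  by apply: val_inj; have := congr1 (divn^~ (t k)) Euv;
     rewrite !divnMDl ?card_dcell_gt0 // !divn_small // !addn0.
by move: Euv; rewrite Eij => /addnI/IHk ->.
Qed.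

Lemma dcell_degree k (x : dcell_vertex n k) :
  #|[set y | dcell_adj x y]| = (n + k).-1.
Proof.
elim: k x => [|k IHk] x.
  rewrite addn0 -[in RHS](card_ord n) -(cardsC1 x).
  by apply: eq_card => y; rewrite !inE eq_sym.
rewrite [LHS](card_copies_adj _ (@uid_lt k) (@uid_inj k)) IHk.
lia.
Qed.

Lemma boundary_complete (S : {set 'I_n}) :
  #|boundary (@dcell_adj n 0) S| = #|S| * (n - #|S|).
Proof.
have -> : boundary (@dcell_adj n 0) S = setX S (~: S).
  apply/setP => -[x y]; rewrite !inE /=.
  by case: (boolP (x \in S)) => //= xS; case: (boolP (y \in S)) => //= yS;
     apply: contraNneq yS => <-.
by rewrite cardsX [#|~: S|]cardsCs setCK card_ord.
Qed.

(** * Counting along the copies of one level *)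

Section Step.

Variables (k : nat) (S : {set dcell_vertex n k.+1}).

Let full := full S.
Let void := void S.
Let mixed := mixed S.

Lemma dcell_copies : #|full| + #|void| + #|mixed| = (t k).+1.
Proof. exact: card_copies (card_dcell_gt0 k). Qed.

Lemma dcell_card_slices :
  t k * #|full| + #|mixed| <= #|S| <= t k * (#|full| + #|mixed|).
Proof. by rewrite leq_card_slices card_slices_leq. Qed.

Lemma dcell_mixed_slice i : i \in mixed -> slice S i != setT /\ slice S i != set0.
Proof. by rewrite inE => /andP. Qed.

(** [X] abstracts the number of cross boundary edges, reducing the later case analyses to
    arithmetic. Without full slices, [S] lives in the mixed copies only. *)
Lemma dcell_boundary_slices d :
  (forall A : {set dcell_vertex n k}, A != set0 -> A != setT ->
     d <= #|boundary (@dcell_adj n k) A|) ->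
  exists X, [/\ d * #|mixed| + X <= #|boundary (@dcell_adj n k.+1) S|,
    #|full| * #|void| <= X &
    #|full| = 0 -> #|S| + #|mixed| <= X + #|mixed| * #|mixed|].
Proof.
move=> leq_d; exists #|cross_boundary (@uid n k) S|; split.
- apply: leq_trans (boundary_slices _ (@uid_lt k) S); rewrite leq_add2r.
  exact: leq_mixed_sum.
- exact: (card_full_void (@uid_lt k) (@uid_inj k) S (card_dcell_gt0 k)).
move=> /eqP; rewrite cards_eq0 => /eqP/setP full0.
apply: (card_leq_cross (@uid_lt k) (@uid_inj k)) => i.
by have := full0 i; rewrite !inE => ->; rewrite negbK => /eqP.
Qed.

Lemma dcell_single_slice :
  #|full| = 0 -> #|mixed| = 1 ->
  exists A : {set dcell_vertex n k}, [/\ A != setT, #|A| = #|S| &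
    #|boundary (@dcell_adj n k) A| + #|S| <= #|boundary (@dcell_adj n k.+1) S|].
Proof.
move=> /eqP; rewrite cards_eq0 => /eqP/setP full0 /eqP/cards1P[i Ei].
exists (slice S i); have /dcell_mixed_slice[-> _] : i \in mixed by rewrite Ei set11.
have [j|-> le] := @card_single_slice _ (@dcell_adj n k) _ (@uid_lt k) (@uid_inj k) S i.
  move=> ji; have := full0 j; have /setP/(_ j) := Ei; rewrite !inE (negbTE ji).
  move=> /negbT; rewrite negb_and !negbK => /orP[fullj notfullj | /eqP //].
  by have := etrans (esym fullj) notfullj.
by split.
Qed.

End Step.

(** Lets a complement-invariant bound assume [#|full S| <= #|void S|]. *)
Lemma card_fullC k (S : {set dcell_vertex n k.+1}) : #|full (~: S)| = #|void S|.
Proof.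
apply: eq_card => i; rewrite !inE -(inj_eq (can_inj setCK)) setCT.
by congr (_ == _); apply/setP => x; rewrite !inE negbK.
Qed.

Lemma card_voidC k (S : {set dcell_vertex n k.+1}) : #|void (~: S)| = #|full S|.
Proof. by rewrite -card_fullC setCK. Qed.

Lemma dcell_boundaryC k (S : {set dcell_vertex n k}) :
  #|boundary (@dcell_adj n k) (~: S)| = #|boundary (@dcell_adj n k) S|.
Proof. exact: card_boundaryC (@dcell_adj_sym n k). Qed.

(** * Lower bounds on boundaries in DCell *)

Lemma dcell_edge_connectivity k (S : {set dcell_vertex n k}) :
  S != set0 -> S != setT -> (n + k).-1 <= #|boundary (@dcell_adj n k) S|.
Proof.
elim: k S => [|k IHk] S S_neq0 S_neqT.
  rewrite boundary_complete addn0.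
  have : #|S| < n.
    by rewrite -[X in _ < X]card_ord -cardsT; apply: proper_card; rewrite properT.
  by apply: leq_pred_mul_sub; rewrite card_gt0.
wlog: S S_neq0 S_neqT / #|full S| <= #|void S| => [wl|le_fv].
  have [|lt_vf] := leqP #|full S| #|void S|; first exact: wl.
  have SC_neq0 : ~: S != set0 by rewrite -setCT (inj_eq (can_inj setCK)).
  have SC_neqT : ~: S != setT by rewrite -setC0 (inj_eq (can_inj setCK)).
  have := wl _ SC_neq0 SC_neqT; rewrite card_fullC card_voidC dcell_boundaryC.
  by apply; apply: ltnW.
have [X [le_b le_X le_X0]] := dcell_boundary_slices S IHk.
have := dcell_copies S; have /andP[_] := dcell_card_slices S.
have := card_dcell_ge k; move: S_neq0; rewrite -card_gt0 addnS /=.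
move: (t k) #|full S| #|void S| #|mixed S| #|S| #|boundary _ S| le_fv le_b le_X le_X0.
(* No mixed copy: full and empty ones number [N + 1], so their product is at least [N]. One: some
   cross edge adds to [n + k - 1]. Two or more suffice alone. *)
move=> N [|a] o [|[|m]] s b; rewrite ?muln0 ?muln1; try nia.
Qed.

(* [#|boundary S| + c * #|S|] is the boundary of [S] in [D_(k+c,n)] when [D_(k,n)]
   is one of the nested copies there: each level adds one edge per vertex. *)
Lemma dcell_weighted_boundary k c (S : {set dcell_vertex n k}) :
  0 < c -> 3 <= k + c \/ (k + c = 2 /\ n = 2) -> 3 <= #|S| -> S != setT ->
  2 * (n + k + c) <= #|boundary (@dcell_adj n k) S| + c * #|S| + 3.
Proof.
elim: k c S => [|k IHk] c S c_gt0 kc S_ge3 S_neqT.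
  have S_lt : #|S| < n.
    by rewrite -[X in _ < X]card_ord -cardsT; apply: proper_card; rewrite properT.
  (* Here [3 <= c], since [3 <= #|S| < n] excludes [n = 2]. *)
  rewrite boundary_complete addn0; apply: leq_mul_sub_weighted => //; lia.
have [X [le_b le_X _]] := dcell_boundary_slices S (@dcell_edge_connectivity k).
have := dcell_copies S; have /andP[] := dcell_card_slices S.
have [[full0 mixed1] | not_single] :
    (#|full S| = 0 /\ #|mixed S| = 1) \/ ~ (#|full S| = 0 /\ #|mixed S| = 1) by lia.
  (* Descend into the only copy, trading one level for one unit of weight. *)
  have [A [A_neqT EA le_A]] := dcell_single_slice full0 mixed1.
  have := IHk c.+1 A isT; rewrite EA; have -> : k + c.+1 = k.+1 + c by lia.
  move=> /(_ kc S_ge3 A_neqT); lia.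
have := card_dcell_ge2 (k := k); have := card_dcell_ge k.
have : k = 0 -> t k = n by move=> ->; exact: card_dcell0.
move: (t k) #|full S| #|void S| #|mixed S| #|S| #|boundary _ S|
  not_single le_b le_X S_ge3.
move=> N a o m s b {IHk S S_neqT} not_single le_b le_X s_ge3 N0 Nge Nge2 s_ge s_le aom.
have cN1 : c + N <= c * N + 1 by apply: leq_add_mul1; lia.
case: m not_single le_b s_ge s_le aom => [|[|m]] not_single le_b s_ge s_le aom.
- rewrite !addn0 muln0 in le_b s_ge s_le aom.
  have Es : s = N * a by lia.
  case: a => [|[|a]] in {not_single} le_X {s_ge s_le} Es aom *; first by lia.
    (* [S] is one whole copy. For [k = 0] its size is [n >= 3], so [kc] forces [c >= 2]. *)
    have [k0|k_gt0] := posnP k; last by have := Nge2 k_gt0; nia.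
    have := N0 k0; rewrite k0 in kc *; nia.
  have [o0|o_gt0] := posnP o; nia.
(* One mixed copy and some full one: if no copy is empty then [a = N >= 2], otherwise a full-empty
   pair gives a cross edge. *)
- have a_gt0 : 0 < a by lia.
  have leq_cs q : q <= a -> c * (N * q + 1) <= c * s.
    move=> le_qa; rewrite leq_mul2l; apply/orP; right; apply: leq_trans s_ge.
    by rewrite leq_add2r leq_mul2l le_qa orbT.
  rewrite muln1 in le_b; have [o0|o_gt0] := posnP o.
    by have := leq_cs 2; lia.
  have := leq_cs 1 a_gt0.
  have : 0 < a * o by rewrite muln_gt0 a_gt0.
  lia.
have : c * 3 <= c * s by rewrite leq_mul2l s_ge3 orbT.
have : (n + k).-1 * 2 <= (n + k).-1 * m.+2 by rewrite leq_mul2l orbT.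
lia.
Qed.

(** With [d = n + k - 1] this is the bound [2d - 1], one above the size of an edge-isolating cut. *)
Lemma dcell_boundary_ge k (S : {set dcell_vertex n k}) :
  3 <= k \/ (k = 2 /\ n = 2) -> 3 <= #|S| -> 3 <= #|~: S| ->
  2 * (n + k) <= #|boundary (@dcell_adj n k) S| + 3.
Proof.
case: k S => [|k] S kn; first by lia.
wlog: S / #|full S| <= #|void S| => [wl S_ge3 SC_ge3|le_fv S_ge3 SC_ge3].
  have [|lt_vf] := leqP #|full S| #|void S|; first by move/wl; apply.
  rewrite -dcell_boundaryC; apply: wl; rewrite ?setCK //.
  by rewrite card_fullC card_voidC ltnW.
have [X [le_b le_X le_X0]] := dcell_boundary_slices S (@dcell_edge_connectivity k).
have := dcell_copies S; have /andP[_] := dcell_card_slices S.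
have [[full0 mixed1] | not_single] :
    (#|full S| = 0 /\ #|mixed S| = 1) \/ ~ (#|full S| = 0 /\ #|mixed S| = 1) by lia.
  have [A [A_neqT EA le_A]] := dcell_single_slice full0 mixed1.
  have := @dcell_weighted_boundary k 1 A isT; rewrite EA addn1.
  move=> /(_ kn S_ge3 A_neqT); lia.
have k_gt0 : 0 < k by lia.
have := card_dcell_ge2 k_gt0; rewrite addnS /=.
move: (t k) #|full S| #|void S| #|mixed S| #|S| #|boundary _ S| le_fv not_single le_b
  le_X le_X0 S_ge3.
move=> N a o m s b le_ao {SC_ge3 S} not_single le_b le_X le_X0 s_ge3 Nge s_le aom.
case: m not_single le_b le_X0 s_le aom => [|[|m]] not_single le_b le_X0 s_le aom.
- by case: a => [|a] in le_ao {not_single} le_X {le_X0} s_le aom *; nia.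
- by case: a => [|a] in le_ao not_single le_X {le_X0} s_le aom *; nia.
case: m {not_single s_le} => [|m] in le_b le_X0 aom *; last first.
  have : (n + k).-1 * 3 <= (n + k).-1 * m.+3 by rewrite leq_mul2l orbT.
  lia.
have X_gt0 : 0 < X; last by lia.
(* Two mixed copies and no full one: at most two vertices of [S] have their cross edge inside [S],
   and [3 <= s]. *)
have [a0|a_gt0] := posnP a; first by have := le_X0 a0; lia.
by apply: leq_trans le_X; rewrite muln_gt0 a_gt0 (leq_trans a_gt0).
Qed.

End DCell.

Theorem theorem8 (k n : nat)
  (hkn : (3 <= k /\ 2 <= n) \/ (k = 2 /\ n = 2)) :
  super_lambda (@dcell_adj n k) 2 /\
  forall F : {set {set dcell_vertex n k}},
    min_restricted_edge_cut (@dcell_adj n k) 2 F ->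
    exists x y : dcell_vertex n k,
      dcell_adj x y /\ [set x; y] \in components (del_edges (@dcell_adj n k) F).
Proof.
have n_ge2 : 2 <= n by lia.
have adj_sym := @dcell_adj_sym n k; have adj_irr := @dcell_adj_irr n k.
have super : super_lambda (@dcell_adj n k) 2.
  move=> F [[_ not_conn comp_ge2] min_F].
  have [/existsP[C /andP[CF /eqP C2]] | no_pair] :=
    boolP [exists C in components (del_edges (@dcell_adj n k) F), #|C| == 2].
    by exists C.
  (* Without a component of size 2, all components have at least three vertices. *)
  have [|S [S_ge3 SC_ge3 le_SF]] := cut_boundary adj_sym (m := 3) not_conn.
    move=> C CF; rewrite ltn_neqAle comp_ge2 // andbT eq_sym.
    by apply: contra no_pair => C2; apply/existsP; exists C; rewrite CF.
  have /card_gt0P[x _] := card_dcell_gt0 n_ge2 k.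
  have deg := @dcell_degree n n_ge2 k.
  have /card_gt0P[y] : 0 < #|[set y | dcell_adj x y]| by rewrite deg; lia.
  rewrite inE => xy.
  have [|F' F'_cut le_F'] := edge_isolating_cut adj_sym adj_irr _ deg xy.
    by lia.
  have := min_F F' F'_cut; have := dcell_boundary_ge n_ge2 _ S_ge3 SC_ge3.
  lia.
split=> // F F_min; have [C CF C2] := super F F_min.
have [x [y [xy EC]]] := pair_component_adj adj_sym adj_irr CF C2.
by exists x, y; split; rewrite // -EC.
Qed.
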